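(* Let $n=2^r$ with $r\ge3$ an integer. The $n\times n$ square produced by the Narayana $N-i$ construction is a Narayana square.
   Context: Throughout $n=2^r$, $r\ge3$, $N=n^2+1$, $M=\frac n2N$; $a_{i,j}$ is the entry in row $i$, column $j$ of an $n\times n$ square, rows numbered from top to bottom and columns from left to right. In the sums below, row and column indices are read modulo $n$ (in $\{1,\dots,n\}$). Narayana square. An $n\times n$ matrix such that: (1) every integer from $\{1,2,\dots,n^2\}$ occurs exactly once (so the magic sum is $M=\frac n2N$); (2) all rows and columns add to $M$; (3) all pandiagonals add to $M$, i.e. for each $c\in\{1,\dots,n\}$, $\sum_{k=1}^n a_{k,c+k-1}=M$ and $\sum_{k=1}^n a_{k,c-k+1}=M$ (indices mod $n$); (4) all $2\times2$ sub-squares add to $2N$, continuously: $a_{i,j}+a_{i+1,j}+a_{i,j+1}+a_{i+1,j+1}=2N$ for all $i,j\in\{1,\dots,n\}$ (indices mod $n$). Up and Down operations. Given a block of $R$ consecutive rows (a part), two columns $C_l$ (the left one) and $C_r$ (the right one), and a starting number $A$: the Up operation places $A,A+1,\dots,A+R-1$ in consecutive rows, one number per row, starting at the bottom row of the part and going upwards, alternating between $C_l$ and $C_r$ and starting in $C_l$. The Down operation places $A,A+1,\dots,A+R-1$ in consecutive rows, one number per row, starting at the top row of the part and going downwards, alternating between $C_l$ and $C_r$ and starting in $C_r$. Narayana $N-i$ construction. The Top part is rows $1,\dots,n/2$ and the Bottom part is rows $n/2+1,\dots,n$. Step 1. For $d=0,1,\dots,n/2-1$ let $C_l$ be column $d+1$,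 $C_r$ be column $n/2+d+1$, and $A=nd+1$. If $d$ is even: apply Up to the Top part with starting number $A$ and Down to the Bottom part with starting number $A+n/2$. If $d$ is odd: apply Up to the Bottom part with starting number $A$ and Down to the Top part with starting number $A+n/2$. Step 2. The empty cells are filled, for $1\le i,j\le n/2$, by: if $i$ is odd, $a_{i,j}=N-a_{n/2+i,\,n/2+j}$ and $a_{n/2+i,\,j}=N-a_{i,\,n/2+j}$; if $i$ is even, $a_{i,\,n/2+j}=N-a_{n/2+i,\,j}$ and $a_{n/2+i,\,n/2+j}=N-a_{i,j}$. *)

(* Defs.v *)
From HB Require Import structures.
From mathcomp Require Import all_boot all_order all_algebra.
Set Implicit Arguments.
Unset Strict Implicit.
Unset Printing Implicit Defensive.
Import Order.TTheory GRing.Theory Num.Theory.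
Local Open Scope ring_scope.

Definition NN (n : nat) : nat := (n ^ 2 + 1)%N.

(* The product is even for every n, so this is exactly n/2 * N.              *)
Definition magic_sum (n : nat) : nat := (n * NN n)./2.

(* Ordinals are 0-based, so [iter k (@ordS n) c] is the column c + k mod n,   *)
(* which in 1-based numbering is column c + k - 1 of row k; likewise          *)
(* [iter k (@ord_pred n) c] is column c - k + 1 of row k.                     *)
Record narayana_square (n : nat) (a : 'M[int]_n) : Prop := NarayanaSquare {
  narayana_once : forall m : nat, (1 <= m <= n ^ 2)%N ->
    #|[set p : 'I_n * 'I_n | a p.1 p.2 == m%:Z]| = 1%N;
  narayana_row : forall i : 'I_n, \sum_j a i j = (magic_sum n)%:Z;
  narayana_col : forall j : 'I_n, \sum_i a i j = (magic_sum n)%:Z;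
  narayana_diag_right : forall c : 'I_n,
    \sum_(k < n) a k (iter k (@ordS n) c) = (magic_sum n)%:Z;
  narayana_diag_left : forall c : 'I_n,
    \sum_(k < n) a k (iter k (@ord_pred n) c) = (magic_sum n)%:Z;
  narayana_block : forall i j : 'I_n,
    a i j + a (ordS i) j + a i (ordS j) + a (ordS i) (ordS j)
      = (2 * NN n)%:Z
}.

(* A partially filled square; rows and columns are numbered from 1, and       *)
(* [None] is an empty cell.                                                   *)
Definition psquare := nat -> nat -> option int.

Definition empty_square : psquare := fun _ _ => None.

Definition put (S : psquare) (i j : nat) (v : option int) : psquare :=
  fun i' j' => if (i' == i) && (j' == j) then v else S i' j'.

(* In [up] and [down], the part is the block of R rows starting at row top,   *)
(* and the k-th number placed (counting from 0) is A + k.                     *)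
Definition up (top R Cl Cr A : nat) (S : psquare) : psquare :=
  foldl (fun T k => put T (top + R.-1 - k) (if odd k then Cr else Cl)
                        (Some (A + k)%N%:Z))
        S (iota 0 R).

Definition down (top R Cl Cr A : nat) (S : psquare) : psquare :=
  foldl (fun T k => put T (top + k) (if odd k then Cl else Cr)
                        (Some (A + k)%N%:Z))
        S (iota 0 R).

Definition step1_round (n : nat) (S : psquare) (d : nat) : psquare :=
  let h := n./2 in
  let Cl := (d + 1)%N in
  let Cr := (h + d + 1)%N in
  let A := (n * d + 1)%N in
  let top_part := 1%N in
  let bottom_part := (h + 1)%N in
  if ~~ odd d
  then down bottom_part h Cl Cr (A + h) (up top_part h Cl Cr A S)
  else down top_part h Cl Cr (A + h) (up bottom_part h Cl Cr A S).

Definition step1 (n : nat) : psquare :=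
  foldl (step1_round n) empty_square (iota 0 n./2).

(* Sets a_{i,j} = N - a_{i',j'}, provided cell (i, j) is still empty.         *)
Definition fill_complement (n : nat) (i j i' j' : nat) (S : psquare)
    : psquare :=
  if S i j is Some _ then S
  else put S i j (omap (fun x => (NN n)%:Z - x) (S i' j')).

Definition step2_round (n : nat) (S : psquare) (p : nat * nat) : psquare :=
  let h := n./2 in
  let: (i, j) := p in
  if odd i
  then fill_complement n (h + i) j i (h + j)
         (fill_complement n i j (h + i) (h + j) S)
  else fill_complement n (h + i) (h + j) i j
         (fill_complement n i (h + j) (h + i) j S).

Definition step2 (n : nat) (S : psquare) : psquare :=
  foldl (step2_round n) S
        [seq (i, j) | i <- iota 1 n./2, j <- iota 1 n./2].

(* A cell left empty would become 0, which never occurs in a Narayana square. *)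
Definition narayana_Ni (n : nat) : 'M[int]_n :=
  \matrix_(i, j) odflt 0 (step2 n (step1 n) i.+1 j.+1).

(* Main.v *)
Require Import Defs.
From mathcomp Require Import all_boot all_order all_algebra.
From mathcomp Require Import zify.

(** Write n = 2h, where h is even, and number rows and columns from 0. The entry
    in row i and column j turns out to be n * w + v with
    0 <= w < n and 1 <= v <= n, where
    - v depends only on the row and on the parity of the column: it is the rank
      u(i) of the row in the order h-1, ..., 0, h, ..., n-1 if j is even, and
      n + 1 - u(i) if j is odd;
    - w depends only on the column and on the parity of the row: with d the
      residue of j modulo h, it is d on the cells that step 1 fills, those where
      i is odd and j < h or i is even and j >= h, and n - 1 - d on the others.
    This is [entry]. That the construction computes it is [narayana_NiE]: a
    round of step 1 acts on a pair of columns only, a round of step 2 on the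
    four cells of a class modulo h only, so each can be read in isolation
    ([foldl_local]); and the complementation of step 2 is consistent with the
    formula because moving by h both ways changes v into n + 1 - v and w into
    n - 1 - w ([entry_half_turn]).

    From the formula all the properties follow. The pair of digits determines
    the cell ([entry_inj]), hence every number occurs once. Each digit is
    complemented by elementary shifts: v by j -> j + 1 and by i -> i + h, and w
    by i -> i + 1 and by j -> j + h. On a row, a column or a pandiagonal, some
    translation of the line thus complements v and some translation complements
    w, which forces the magic sum ([sum_entry]); and in a 2 x 2 block
    complementary digits pair up ([entry_block]). *)

(** * The two digits of an entry *)

(** Reading the bottom half downwards after the top half upwards turns the rows
    into 1, ..., n: in a column of even index the numbers placed in step 1
    increase along this order, in one of odd index they decrease. *)
Definition row_rank (h i : nat) : nat := if i < h then h - i else i.+1.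

Definition in_step1 (h i j : nat) : bool := odd i == (j < h).

Definition low (h i j : nat) : nat :=
  if odd j then h.*2.+1 - row_rank h i else row_rank h i.

Definition high (h i j : nat) : nat :=
  if in_step1 h i j then j %% h else h.*2.-1 - j %% h.

(** Closed form of the constructed square. The low digit ranges over 1, ..., n
    rather than 0, ..., n - 1 because the numbers of the square start at 1. *)
Definition entry (h i j : nat) : nat := h.*2 * high h i j + low h i j.

(** Translation by h modulo 2h. It is an iterate of [ordS] so that its
    injectivity comes from that of [ordS]. *)
Definition half_turn {h} (i : 'I_h.*2) : 'I_h.*2 := iter h (@ordS h.*2) i.

Lemma val_iter_ordS n k (c : 'I_n) : iter k (@ordS n) c = (c + k) %% n :> nat.
Proof.
elim: k => [|k IHk]; first by rewrite addn0 modn_small.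
by rewrite iterS /= IHk -addn1 modnDml addn1 addnS.
Qed.

Lemma val_iter_ord_pred n k (c : 'I_n) :
  iter k (@ord_pred n) c + k = c %[mod n].
Proof.
elim: k => [|k IHk]; first by rewrite addn0.
rewrite iterS -{}IHk; set x := iter k _ c; have x_lt := ltn_ord x.
rewrite /= modnDml -addSnnS prednK; last by lia.
by rewrite addnAC modnDr.
Qed.

Lemma val_half_turn h (i : 'I_h.*2) : half_turn i = (i + h) %% h.*2 :> nat.
Proof. exact: val_iter_ordS. Qed.

Lemma half_turn_inj h : injective (@half_turn h).
Proof.
have iter_inj k : injective (iter k (@ordS h.*2)).
  by elim: k => [|k IHk] x y //= /ordS_inj /IHk.
exact: iter_inj.
Qed.

Lemma row_rank_bounds h i : i < h.*2 -> 0 < row_rank h i <= h.*2.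
Proof. rewrite /row_rank; case: ifP; lia. Qed.

Lemma row_rank_inj h i i' : i < h.*2 -> i' < h.*2 ->
  row_rank h i = row_rank h i' -> i = i'.
Proof. rewrite /row_rank; do 2 case: ifP; lia. Qed.

Lemma add_half_mod h i : i < h.*2 ->
  (i + h) %% h.*2 = if i < h then i + h else i - h.
Proof.
move=> i_lt; case: ltnP => ih; first by rewrite modn_small //; lia.
have -> : i + h = (i - h) + h.*2 by lia.
by rewrite modnDr modn_small //; lia.
Qed.

Lemma high_lt h i j : j < h.*2 -> high h i j < h.*2.
Proof.
move=> j_lt; have := @ltn_pmod j h ltac:(lia).
rewrite /high; case: ifP; lia.
Qed.

Lemma low_bounds h i j : i < h.*2 -> 0 < low h i j <= h.*2.
Proof. by move=> /row_rank_bounds; rewrite /low; case: ifP; lia. Qed.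

(** The magic sums and the block sums all come from complement laws such as this
    one: under a shift of the row or of the column, a digit turns into its
    complement. The wrap-around from the last column to the first respects the
    alternation because n is even. *)
Lemma low_succ_col h (i j : 'I_h.*2) : low h i j + low h i (ordS j) = h.*2.+1.
Proof.
have := @row_rank_bounds h i (ltn_ord i).
by rewrite /low /= odd_mod ?odd_double //=; case: (odd j) => /=; lia.
Qed.

Lemma low_half_row h (i : 'I_h.*2) j :
  low h i j + low h (half_turn i) j = h.*2.+1.
Proof.
have := ltn_ord i; have := @row_rank_bounds h i (ltn_ord i).
rewrite /low val_half_turn add_half_mod // /row_rank.
by case: (odd j); case: (ltnP i h) => ?; case: ifP; lia.
Qed.

Lemma low_half_col h i (j : 'I_h.*2) : ~~ odd h ->
  low h i (half_turn j) = low h i j.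
Proof.
move=> h_even.
by rewrite /low val_half_turn odd_mod ?odd_double // oddD (negbTE h_even) addbF.
Qed.

Lemma in_step1_half_col h i (j : 'I_h.*2) :
  in_step1 h i (half_turn j) = ~~ in_step1 h i j.
Proof.
rewrite /in_step1 val_half_turn add_half_mod //; have := ltn_ord j.
by case: (odd i); case: (ltnP j h); lia.
Qed.

Lemma high_succ_row h (i j : 'I_h.*2) :
  high h i j + high h (ordS i) j = h.*2.-1.
Proof.
have := @ltn_pmod j h ltac:(have := ltn_ord j; lia).
rewrite /high /in_step1 /= odd_mod ?odd_double //=.
by case: (odd i); case: (j < h) => /=; lia.
Qed.

Lemma high_half_col h i (j : 'I_h.*2) :
  high h i j + high h i (half_turn j) = h.*2.-1.
Proof.
have := @ltn_pmod j h ltac:(have := ltn_ord j; lia).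
have half_mod : half_turn j = j %[mod h].
  by rewrite val_half_turn modn_dvdm ?modnDr // -muln2 dvdn_mulr.
rewrite /high half_mod in_step1_half_col.
by case: (in_step1 h i j) => /=; lia.
Qed.

Lemma high_half_row h (i : 'I_h.*2) j : ~~ odd h ->
  high h (half_turn i) j = high h i j.
Proof.
move=> h_even.
by rewrite /high /in_step1 val_half_turn odd_mod ?odd_double // oddD
           (negbTE h_even) addbF.
Qed.

(** * Sums and blocks of the closed form *)

Lemma complementary_digits h a b c d : 0 < h ->
  a + c = h.*2.-1 -> b + d = h.*2.+1 ->
  h.*2 * a + b + (h.*2 * c + d) = NN h.*2.
Proof.
move=> h_gt0 ac bd; rewrite /NN.
have -> : h.*2 * a + b + (h.*2 * c + d) = h.*2 * (a + c) + (b + d) by lia.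
rewrite ac bd; nia.
Qed.

Lemma entry_half_turn h (i j : 'I_h.*2) : ~~ odd h ->
  entry h i j + entry h (half_turn i) (half_turn j) = NN h.*2.
Proof.
move=> h_even; apply: complementary_digits; first by have := ltn_ord j; lia.
  by rewrite high_half_row // high_half_col.
by rewrite low_half_col // low_half_row.
Qed.

(** Uniqueness of a base-n expansion whose low digit runs over 1, ..., n. *)
Lemma digits_inj n a b a' b' : 0 < b <= n -> 0 < b' <= n ->
  n * a + b = n * a' + b' -> a = a' /\ b = b'.
Proof.
move=> /andP[b_gt0 b_le] /andP[b'_gt0 b'_le] eq_ab.
have a_eq : a = a'.
  apply/eqP; case: ltngtP => // aa'.
    by have := leq_mul (leqnn n) aa'; rewrite mulnS; lia.
  by have := leq_mul (leqnn n) aa'; rewrite mulnS; lia.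
by split=> //; move: eq_ab; rewrite a_eq => /addnI.
Qed.

(** The high digit is below h exactly on the cells of step 1, so it determines
    both the column modulo h and whether the cell is one of those. The parity
    of the column then lets the low digit determine the row, and the parity of
    the row tells in which half the column lies. *)
Lemma entry_inj h (i j i' j' : 'I_h.*2) : ~~ odd h ->
  entry h i j = entry h i' j' -> (i, j) = (i', j').
Proof.
move=> h_even; rewrite /entry => eq_entry.
have [eq_high eq_low] := digits_inj _ _ _ _ _ (low_bounds h i j (ltn_ord i))
  (low_bounds h i' j' (ltn_ord i')) eq_entry.
have h_gt0 : 0 < h by have := ltn_ord j; lia.
have := ltn_pmod j h_gt0; have := ltn_pmod j' h_gt0 => dj' dj.
(* A value d of one kind of cell differs from a value n - 1 - d' of the other,
   since d and d' are both below h. *)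
have [eq_fill eq_d] : in_step1 h i j = in_step1 h i' j' /\ j = j' %[mod h].
  move: eq_high dj dj'; rewrite /high.
  move: (j %% h) (j' %% h) => d d'.
  by case: (in_step1 h i j); case: (in_step1 h i' j') => /= *; lia.
have eq_odd : odd j = odd j'.
  by rewrite -(odd_mod j (negbTE h_even)) eq_d odd_mod ?(negbTE h_even).
have eq_i : i = i' :> nat.
  apply: (@row_rank_inj h) => //; move: eq_low; rewrite /low eq_odd.
  have := @row_rank_bounds h i (ltn_ord i).
  have := @row_rank_bounds h i' (ltn_ord i').
  by case: (odd j'); lia.
have eq_side : (j < h) = (j' < h).
  by move: eq_fill; rewrite /in_step1 eq_i; case: (odd i'); do 2 case: (_ < h).
have eq_j : j = j' :> nat.
  rewrite (divn_eq j h) (divn_eq j' h) eq_d; congr (_ * _ + _).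
  have quo (k : 'I_h.*2) : k %/ h = ~~ (k < h).
    case: ltnP => kh; first by rewrite divn_small.
    have -> : k = (k - h) + h :> nat by lia.
    by rewrite divnDr // divnn h_gt0 divn_small //; have := ltn_ord k; lia.
  by rewrite !quo eq_side.
by congr (_, _); apply: val_inj.
Qed.

(** There are as many cells as values, so injectivity gives surjectivity. *)
Lemma card_once n (f : 'I_n * 'I_n -> nat) m : injective f ->
  (forall p, 0 < f p <= n ^ 2) -> 0 < m <= n ^ 2 ->
  #|[set p | f p == m]| = 1.
Proof.
move=> f_inj f_bounds m_bounds.
have pred_lt k : 0 < k <= n ^ 2 -> k.-1 < n ^ 2 by lia.
pose g p := Ordinal (pred_lt _ (f_bounds p)).
have g_inj : injective g.
  move=> p q /(congr1 val) /= eq_pred; apply: f_inj.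
  by have := f_bounds p; have := f_bounds q; lia.
have [g' gK g'K] : bijective g.
  by apply: inj_card_bij => //; rewrite card_prod !card_ord mulnn.
apply/eqP/cards1P; exists (g' (Ordinal (pred_lt _ m_bounds))).
apply/setP => p; rewrite !inE -(inj_eq g_inj) g'K.
have := f_bounds p; rewrite -val_eqE /=; lia.
Qed.

(** Summing over [i] and over [s i] gives the same total, so twice the sum is a
    sum of n copies of [c]. *)
Lemma sum_complement n (s : 'I_n -> 'I_n) (f : 'I_n -> nat) c : injective s ->
  (forall i, f i + f (s i) = c) -> (\sum_i f i).*2 = n * c.
Proof.
move=> s_inj f_s; rewrite -addnn {2}(reindex_inj s_inj) -big_split /=.
by rewrite (eq_bigr (fun=> c)) // sum_nat_const card_ord.
Qed.

(** A line of cells [(r k, c k)] is magic as soon as each digit is complemented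
    by some shift of the parameter. The shifts [s] and [t] may differ: along a
    row or a column one digit is complemented by a step of one and the other by
    a step of h. *)
Lemma sum_entry h (r c : 'I_h.*2 -> 'I_h.*2) (s t : 'I_h.*2 -> 'I_h.*2) :
  injective s -> injective t ->
  (forall k, high h (r k) (c k) + high h (r (s k)) (c (s k)) = h.*2.-1) ->
  (forall k, low h (r k) (c k) + low h (r (t k)) (c (t k)) = h.*2.+1) ->
  \sum_k entry h (r k) (c k) = magic_sum h.*2.
Proof.
move=> s_inj t_inj high_s low_t; apply: double_inj.
rewrite /entry big_split -big_distrr doubleD /= doubleMr.
rewrite (sum_complement _ _ _ _ s_inj high_s).
rewrite (sum_complement _ _ _ _ t_inj low_t).
have -> : magic_sum h.*2 = h * NN h.*2 by rewrite /magic_sum -doubleMl doubleK.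
by rewrite /NN; case: h {r c s t s_inj t_inj high_s low_t} => [|h]; nia.
Qed.

(** The high digits are complementary in each column and the low digits in each
    row, so the high digits of a column may be grouped with the low digits of a
    row even though they do not come from the same two cells. *)
Lemma entry_block h (i j : 'I_h.*2) :
  entry h i j + entry h (ordS i) j + entry h i (ordS j)
    + entry h (ordS i) (ordS j) = 2 * NN h.*2.
Proof.
have h_gt0 : 0 < h by have := ltn_ord j; lia.
have := complementary_digits _ _ _ _ _ h_gt0 (high_succ_row _ i j)
  (low_succ_col _ i j).
have := complementary_digits _ _ _ _ _ h_gt0 (high_succ_row _ i (ordS j))
  (low_succ_col _ (ordS i) j).
rewrite /entry; lia.
Qed.

(** On a pandiagonal, translating the parameter by h translates the row and the
    column by h. *)
Lemma iter_ordS_half h (k c : 'I_h.*2) :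
  iter (half_turn k) (@ordS h.*2) c = half_turn (iter k (@ordS h.*2) c).
Proof.
apply: val_inj; rewrite /half_turn /= !val_iter_ordS.
by rewrite modnDmr modnDml addnA.
Qed.

Lemma iter_ord_pred_half h (k c : 'I_h.*2) :
  iter (half_turn k) (@ord_pred h.*2) c = half_turn (iter k (@ord_pred h.*2) c).
Proof.
have mod_inj (x y : 'I_h.*2) : x = y %[mod h.*2] -> x = y.
  by rewrite !modn_small // => /val_inj.
apply/mod_inj/eqP; rewrite -(eqn_modDr (half_turn k)) val_iter_ord_pred.
rewrite !val_half_turn modnDml modnDmr addnACA addnn modnDr.
by rewrite val_iter_ord_pred.
Qed.

Lemma narayana_entry h : ~~ odd h ->
  narayana_square (\matrix_(i, j < h.*2) (entry h i j)%:Z)%R.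
Proof.
move=> h_even.
have succ_inj : injective (@ordS h.*2) := @ordS_inj _.
have turn_inj := @half_turn_inj h.
have sumZ (r c : 'I_h.*2 -> 'I_h.*2) :
    \sum_k entry h (r k) (c k) = magic_sum h.*2 ->
    (\sum_k (\matrix_(i, j < h.*2) (entry h i j)%:Z) (r k) (c k)
       = (magic_sum h.*2)%:Z)%R.
  move=> <-; rewrite (big_morph Posz PoszD (erefl _)).
  by apply: eq_bigr => k _; rewrite mxE.
split.
- move=> m m_bounds.
  rewrite -[RHS](card_once _ (fun p => entry h p.1 p.2) m _ _ m_bounds).
  + by apply: eq_card => p; rewrite !inE mxE.
  + by move=> [i j] [i' j'] /entry_inj; apply.
  + move=> [i j] /=.
    have := @low_bounds h i j (ltn_ord i); have := @high_lt h i j (ltn_ord j).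
    by rewrite /entry; nia.
- move=> i; apply: (sumZ (fun=> i) id).
  apply: (sum_entry _ (fun=> i) id half_turn (@ordS _)) => // k.
    exact: high_half_col.
  exact: low_succ_col.
- move=> j; apply: (sumZ id (fun=> j)).
  apply: (sum_entry _ id (fun=> j) (@ordS _) half_turn) => // k.
    exact: high_succ_row.
  exact: low_half_row.
- move=> c; apply: (sumZ id (fun k => iter k (@ordS _) c)).
  apply: (sum_entry _ id _ half_turn half_turn) => // k /=;
    rewrite iter_ordS_half.
    by rewrite high_half_row // high_half_col.
  by rewrite low_half_col // low_half_row.
- move=> c; apply: (sumZ id (fun k => iter k (@ord_pred _) c)).
  apply: (sum_entry _ id _ half_turn half_turn) => // k /=;
    rewrite iter_ord_pred_half.
    by rewrite high_half_row // high_half_col.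
  by rewrite low_half_col // low_half_row.
- by move=> i j; rewrite !mxE -!PoszD entry_block.
Qed.

(** * The construction computes the closed form *)

Definition agree (D : nat -> nat -> bool) (S T : psquare) : Prop :=
  forall i j, D i j -> S i j = T i j.

Lemma foldl_frame (A : eqType) (F : psquare -> A -> psquare) D (s : seq A) S :
  (forall y T, y \in s -> agree D (F T y) T) -> agree D (foldl F S s) S.
Proof.
elim: s S => [|y s IHs] S frame i j Dij //=.
rewrite IHs //; first by rewrite frame // mem_head.
by move=> z T z_s; apply: frame; rewrite in_cons z_s orbT.
Qed.

(** If a single step [x] of a run acts on the region [D], the result on [D] is
    that of [x] applied to a square which still has its initial content there.
    The region, rather than one cell, is what step 2 requires: the numbers it
    writes are computed from other cells of the region. *)
Lemma foldl_local (A : eqType) (F : psquare -> A -> psquare) D (s : seq A) x S :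
  uniq s -> x \in s ->
  (forall y T, y \in s -> y != x -> agree D (F T y) T) ->
  exists2 T, agree D T S & agree D (foldl F S s) (F T x).
Proof.
move=> s_uniq x_s; case/splitPr: x_s s_uniq => s1 s2.
rewrite uniq_catC /= mem_cat negb_or => /andP[/andP[x_s2 x_s1] _] frame.
exists (foldl F S s1).
  apply: foldl_frame => y T y_s1; apply: frame; first by rewrite mem_cat y_s1.
  by apply: contraNneq x_s1 => <-.
rewrite foldl_cat /=; apply: foldl_frame => y T y_s2.
apply: frame; first by rewrite mem_cat in_cons y_s2 !orbT.
by apply: contraNneq x_s2 => <-.
Qed.

Lemma up_cell top R Cl Cr A S i j : top <= i < top + R ->
  let k := top + R.-1 - i in
  up top R Cl Cr A S i j =
    if j == (if odd k then Cr else Cl) then Some (Posz (A + k)) else S i j.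
Proof.
move=> i_part k.
have [||y T|T TS eq_up] :=
  @foldl_local _ (fun T k => put T (top + R.-1 - k) (if odd k then Cr else Cl)
                        (Some (Posz (A + k))))
    (fun i' _ => i' == i) (iota 0 R) k S.
- exact: iota_uniq.
- by rewrite mem_iota; lia.
- rewrite mem_iota => y_lt y_k i' j' /eqP ->; rewrite /put.
  by case: ifP => // /andP[/eqP i_eq _]; lia.
rewrite /up eq_up // /put TS //.
by have -> : i == top + R.-1 - k by lia.
Qed.

Lemma down_cell top R Cl Cr A S i j : top <= i < top + R ->
  let k := i - top in
  down top R Cl Cr A S i j =
    if j == (if odd k then Cl else Cr) then Some (Posz (A + k)) else S i j.
Proof.
move=> i_part k.
have [||y T|T TS eq_down] :=
  @foldl_local _ (fun T k => put T (top + k) (if odd k then Cl else Cr)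
                        (Some (Posz (A + k))))
    (fun i' _ => i' == i) (iota 0 R) k S.
- exact: iota_uniq.
- by rewrite mem_iota; lia.
- rewrite mem_iota => y_lt y_k i' j' /eqP ->; rewrite /put.
  by case: ifP => // /andP[/eqP i_eq _]; lia.
rewrite /down eq_down // /put TS //.
by have -> : i == top + k by lia.
Qed.

Lemma up_frame top R Cl Cr A S i j :
  ~~ (top <= i < top + R) || ((j != Cl) && (j != Cr)) ->
  up top R Cl Cr A S i j = S i j.
Proof.
move=> off; apply: (@foldl_frame _ _ (fun i' j' => (i' == i) && (j' == j))).
  move=> k T; rewrite mem_iota => k_lt _ _ /andP[/eqP-> /eqP->]; rewrite /put.
  by case: ifP => // /andP[/eqP i_eq /eqP j_eq]; move: off j_eq; case: ifP; lia.
by rewrite !eqxx.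
Qed.

Lemma down_frame top R Cl Cr A S i j :
  ~~ (top <= i < top + R) || ((j != Cl) && (j != Cr)) ->
  down top R Cl Cr A S i j = S i j.
Proof.
move=> off; apply: (@foldl_frame _ _ (fun i' j' => (i' == i) && (j' == j))).
  move=> k T; rewrite mem_iota => k_lt _ _ /andP[/eqP-> /eqP->]; rewrite /put.
  by case: ifP => // /andP[/eqP i_eq /eqP j_eq]; move: off j_eq; case: ifP; lia.
by rewrite !eqxx.
Qed.

Lemma step1_round_frame h S d i j : j != d + 1 -> j != h + d + 1 ->
  step1_round h.*2 S d i j = S i j.
Proof.
move=> jl jr; rewrite /step1_round doubleK.
by case: ifP => _; rewrite ?(up_frame, down_frame) // jl jr orbT.
Qed.

Lemma mod_half {h j} : j < h.*2 -> j %% h = if j < h then j else j - h.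
Proof.
move=> j_lt; case: ltnP => jh; first by rewrite modn_small.
by rewrite -{1}(subnK jh) modnDr modn_small //; lia.
Qed.

(* The parity of the column and the part that contains the row decide between Up
   and Down and fix the form of the low digit; what remains is to compare the
   columns and the values. *)
Ltac compare_cells i j h jh :=
  case: (odd i); case: (ltnP j h) => jh /=; case: ifP => /= ?;
  solve [done | lia | congr (Some _); lia].

(** The number of rows of a part is even, so that Up and Down select the same
    cells: in both parts the rows of odd 0-based index get their number on the
    left, the others on the right. *)
Lemma step1_round_cell h S i j : ~~ odd h -> i < h.*2 -> j < h.*2 ->
  step1_round h.*2 S (j %% h) i.+1 j.+1 =
    if in_step1 h i j then Some (Posz (entry h i j)) else S i.+1 j.+1.
Proof.
move=> h_even i_lt j_lt; rewrite /step1_round doubleK.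
have odd_d : odd (j %% h) = odd j by rewrite odd_mod ?(negbTE h_even).
rewrite {1}odd_d /entry /low /high.
have [ih|ih] := ltnP i h; case j_odd : (odd j) => /=.
- rewrite down_cell ?up_frame; try lia.
  have -> : odd (i.+1 - 1) = odd i by lia.
  rewrite /in_step1 /row_rank ih (mod_half j_lt).
  compare_cells i j h jh.
- rewrite down_frame ?up_cell; try lia.
  have -> : odd (1 + h.-1 - i.+1) = ~~ odd i by lia.
  rewrite /in_step1 /row_rank ih (mod_half j_lt).
  compare_cells i j h jh.
- rewrite down_frame ?up_cell; try lia.
  have -> : odd (h + 1 + h.-1 - i.+1) = ~~ odd i by lia.
  rewrite /in_step1 /row_rank (ltnNge i) ih (mod_half j_lt) /=.
  compare_cells i j h jh.
- rewrite down_cell ?up_frame; try lia.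
  have -> : odd (i.+1 - (h + 1)) = odd i by lia.
  rewrite /in_step1 /row_rank (ltnNge i) ih (mod_half j_lt) /=.
  compare_cells i j h jh.
Qed.

Lemma step1_cell h i j : ~~ odd h -> i < h.*2 -> j < h.*2 ->
  step1 h.*2 i.+1 j.+1 =
    if in_step1 h i j then Some (Posz (entry h i j)) else None.
Proof.
move=> h_even i_lt j_lt; have h_gt0 : 0 < h by lia.
rewrite /step1 doubleK.
have [||d T|T T_empty ->//] := @foldl_local _ (step1_round h.*2)
  (fun _ j' => j' == j.+1) (iota 0 h) (j %% h) empty_square.
- exact: iota_uniq.
- by rewrite mem_iota ltn_pmod.
- rewrite mem_iota => d_lt d_j i' _ /eqP->.
  move: d_j; rewrite (mod_half j_lt) => d_j.
  by apply: step1_round_frame; move: d_j; case: ifP; lia.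
by rewrite step1_round_cell // T_empty.
Qed.

Lemma step2_round_frame h S p i j : p.1 <= h -> p.2 <= h ->
  ~~ ((i \in [:: p.1; h + p.1]) && (j \in [:: p.2; h + p.2])) ->
  step2_round h.*2 S p i j = S i j.
Proof.
case: p => p q /= p_le q_le; rewrite !inE => off.
have fillE a b a' b' T : (a == p) || (a == h + p) -> (b == q) || (b == h + q) ->
    fill_complement h.*2 a b a' b' T i j = T i j.
  move=> a_in b_in; rewrite /fill_complement; case: (T a b) => // .
  rewrite /put; case: ifP => // /andP[/eqP ia /eqP jb].
  by rewrite ia jb a_in b_in in off.
by rewrite /step2_round doubleK; case: ifP => _; rewrite !fillE ?eqxx ?orbT.
Qed.

(** The cells congruent to (i, j) modulo h form a region that a single round
    reads and writes. On it step 1 has filled two cells, and the round writes at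
    the other two the complement to N of the diagonally opposite one, as
    [entry_half_turn] prescribes. *)
Lemma step2_cell h i j : ~~ odd h -> i < h.*2 -> j < h.*2 ->
  step2 h.*2 (step1 h.*2) i.+1 j.+1 = Some (Posz (entry h i j)).
Proof.
move=> h_even i_lt j_lt; have h_gt0 : 0 < h by lia.
set p := i %% h; set q := j %% h.
have [p_lt q_lt] : p < h /\ q < h by rewrite !ltn_pmod.
have i_p : i = p \/ i = h + p by rewrite /p (mod_half i_lt); case: ifP; lia.
have j_q : j = q \/ j = h + q by rewrite /q (mod_half j_lt); case: ifP; lia.
pose D (i' j' : nat) :=
  (i' \in [:: p.+1; h + p.+1]) && (j' \in [:: q.+1; h + q.+1]).
have [||[a b] T|T TS eq_S] := @foldl_local _ (step2_round h.*2) D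
  [seq (i, j) | i <- iota 1 h, j <- iota 1 h] (p.+1, q.+1) (step1 h.*2).
- by apply: allpairs_uniq; rewrite ?iota_uniq // => -[? ?] [? ?] _ _ [-> ->].
- by apply: allpairs_f; rewrite mem_iota; lia.
- case/allpairsP=> -[a' b'] /=; rewrite !mem_iota => -[a_in b_in [-> ->]] ab.
  move=> i' j' Dij; apply: (@step2_round_frame h T (a', b')) => /=;
    [by lia | by lia |].
  by move: ab Dij; rewrite /D !inE xpair_eqE; lia.
rewrite /step2 doubleK eq_S; last by rewrite /D !inE; lia.
have compl a b : a < h -> b < h.*2 ->
    entry h (h + a) (if b < h then h + b else b - h) + entry h a b = NN h.*2.
  move=> a_lt b_lt; have a_lt2 : a < h.*2 by lia.
  have := @entry_half_turn h (Ordinal a_lt2) (Ordinal b_lt) h_even.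
  rewrite !val_half_turn !add_half_mod //= a_lt addnC.
  by rewrite ![_ + h]addnC.
have c1 := compl p q p_lt ltac:(lia).
have c2 := compl p (h + q) p_lt ltac:(lia).
rewrite q_lt in c1; rewrite ltnNge leq_addr /= addKn in c2.
have cell a b : a < h.*2 -> b < h.*2 -> D a.+1 b.+1 ->
    T a.+1 b.+1 = if in_step1 h a b then Some (Posz (entry h a b)) else None.
  by move=> a_lt b_lt Dab; rewrite TS // step1_cell.
have T00 := cell p q ltac:(lia) ltac:(lia) ltac:(rewrite /D !inE; lia).
have T01 := cell p (h + q) ltac:(lia) ltac:(lia) ltac:(rewrite /D !inE; lia).
have T10 := cell (h + p) q ltac:(lia) ltac:(lia) ltac:(rewrite /D !inE; lia).
have T11 := cell (h + p) (h + q) ltac:(lia) ltac:(lia)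
  ltac:(rewrite /D !inE; lia).
move: T00 T01 T10 T11; rewrite /in_step1 oddD (negbTE h_even) /= q_lt.
have -> : (h + q < h) = false by lia.
have row_neq : (p.+1 == h + p.+1) = false by lia.
have col_neq : (q.+1 == h + q.+1) = false by lia.
have row_neq' : (h + p.+1 == p.+1) = false by lia.
have col_neq' : (h + q.+1 == q.+1) = false by lia.
rewrite /step2_round doubleK /= -!addnS.
case: (odd p) => /= T00 T01 T10 T11; rewrite /fill_complement.
all: do 2 rewrite ?T00 ?T01 ?T10 ?T11 /put /= ?row_neq ?col_neq ?row_neq'
  ?col_neq' ?eqxx /=.
all: case: i_p j_q => -> [] ->; rewrite -?addnS.
all: rewrite ?T00 ?T01 ?T10 ?T11 /= ?eqxx ?row_neq ?col_neq ?row_neq' ?col_neq'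
  /= ?T00 ?T01 ?T10 ?T11.
all: congr Some; lia.
Qed.

Lemma narayana_NiE h : ~~ odd h ->
  narayana_Ni h.*2 = (\matrix_(i, j) (entry h i j)%:Z)%R.
Proof. by move=> h_even; apply/matrixP => i j; rewrite !mxE step2_cell. Qed.

Theorem proposition3p1 (r : nat) (hr : (3 <= r)%N) :
  narayana_square (narayana_Ni (2 ^ r)).
Proof.
case: r hr => // r r_ge2; have h_even : ~~ odd (2 ^ r) by rewrite oddX; lia.
by rewrite expnS mul2n narayana_NiE //; apply: narayana_entry.
Qed.
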